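(* Let $k$ be a field of characteristic $p > 0$. Suppose that $G$ is a finite group having an elementary abelian subgroup $E$ of $p$-rank $2$. Let $\mathcal{S}$ be the collection consisting of all indecomposable projective $kG$-modules and all one dimensional $kG$-modules. If $$0 \to C^0 \to C^1 \to \cdots \to C^{\ell-1} \to C^\ell \to 0$$ is a bounded exact sequence of $kG$-modules, each term of which lies in $\mathsf{Add}(\mathcal{S})$, then the complex $C^*$ is contractible.
   Context: An elementary abelian subgroup of $p$-rank $2$ is a subgroup isomorphic to $C_p \times C_p$, where $C_p$ is the cyclic group of order $p$. For a collection $\mathcal{S}$ of finitely generated $kG$-modules, $\mathsf{Add}(\mathcal{S})$ is the full additive subcategory of the category of $kG$-modules consisting of all $kG$-modules that are isomorphic to finite direct sums of copies of objects in $\mathcal{S}$. Contractible means that the identity map of the complex of $kG$-modules is chain homotopic to zero via $kG$-homomorphisms. *)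

(* Defs.v *)
From HB Require Import structures.
From mathcomp Require Import all_boot all_order all_algebra.
From mathcomp Require Import all_fingroup all_solvable all_field all_character.

Set Implicit Arguments.
Unset Strict Implicit.
Unset Printing Implicit Defensive.

Import GroupScope GRing.Theory.
Local Open Scope ring_scope.

(* A finitely generated kG-module is a matrix representation of G over k: the
   module is the space of row vectors 'rV[k]_n, on which g acts by
   v |-> v *m M g. Linear maps also act on the right, so that A *m B is "first
   A, then B"; a map is surjective iff its matrix is row_full, and its kernel
   and image are the row spaces of kermx A and A. *)

Section Modules.

Variables (k : fieldType) (gT : finGroupType) (G : {group gT}).
Local Notation kGmod := (representation k G).

Definition kG_hom (M N : kGmod) (A : 'M[k]_(rdegree M, rdegree N)) : Prop :=
  forall g, g \in G -> M g *m A = A *m N g.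

Definition projective (P : kGmod) : Prop :=
  forall (M N : kGmod) (q : 'M[k]_(rdegree M, rdegree N))
         (f : 'M[k]_(rdegree P, rdegree N)),
    kG_hom q -> row_full q -> kG_hom f ->
  exists2 h : 'M[k]_(rdegree P, rdegree M), kG_hom h & h *m q = f.

Definition indecomposable (M : kGmod) : Prop :=
  (rdegree M != 0)%N /\
  forall U V : 'M[k]_(rdegree M),
    mxmodule M U -> mxmodule M V ->
    (U + V == 1%:M)%MS -> mxdirect (U + V) ->
  U = 0 \/ V = 0.

Definition proj_or_onedim (M : kGmod) : Prop :=
  (indecomposable M /\ projective M) \/ rdegree M = 1%N.

(* The empty sum is the zero module grepr0. *)
Definition in_Add (S : kGmod -> Prop) (M : kGmod) : Prop :=
  exists (m : nat) (U : 'I_m -> kGmod),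
    (forall i, S (U i)) /\ mx_rsim M (\big[dadd_grepr/grepr0]_(i < m) U i).

(* Cochain complexes in degrees >= 0, all terms in negative degrees being 0. *)
Record cochain_complex := CochainComplex {
  term :> nat -> kGmod;
  diff : forall i, 'M[k]_(rdegree (term i), rdegree (term i.+1));
  diff_hom : forall i, kG_hom (diff i);
  diff_diff : forall i, diff i *m diff i.+1 = 0
}.

Definition bounded_by (l : nat) (C : cochain_complex) : Prop :=
  forall i, (l < i)%N -> rdegree (C i) = 0%N.

(* The first conjunct is exactness in degree 0. If C is bounded by l, the
   second one for i.+1 = l says that the last map C (l - 1) -> C l is onto. *)
Definition exact_complex (C : cochain_complex) : Prop :=
  (kermx (diff C 0) == (0 : 'M[k]_(rdegree (C 0%N))))%MS /\
  forall i, (kermx (diff C i.+1) == diff C i)%MS.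

(* s i is the component C^(i+1) -> C^i of the contracting homotopy; the
   component out of C^0 is 0, which gives the separate equation in degree 0. *)
Definition contractible (C : cochain_complex) : Prop :=
  exists s : forall i, 'M[k]_(rdegree (C i.+1), rdegree (C i)),
    [/\ forall i, kG_hom (s i),
        diff C 0 *m s 0%N = 1%:M &
        forall i, s i *m diff C i + diff C i.+1 *m s i.+1 = 1%:M].

End Modules.

(* Main.v *)
(* Restrict to E = H x K with H = <g> and K of order p, and write C^i = L + P
   with G acting diagonally on L and P projective. Then E acts trivially on L,
   so the norm N_K kills L, and N_K C^i is relatively projective over H. If w in
   C^i is fixed by E and the L-component of d w vanishes, then
   d w = N_H N_K c; as the kernels of N_H and g - 1 on N_K C^j are the images
   of g - 1 and N_H, one can lift along the complex, alternating between N_H and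
   g - 1 until the complex ends, and exactness then leads back to
   d w = N_H (d v) for some v in C^i.
   By induction on i the cycles of C^i split off. Up to a generalized inverse
   of the L-components of d, the previous identity says that a complement of
   the cycles has an idempotent with zero L -> L component, hence is projective,
   hence injective, and d is von Neumann regular in the category of kG-modules
   (d r d = d). Regularity of all the differentials and exactness give the
   contraction. *)

From HB Require Import structures.
Require Import Defs.
From mathcomp Require Import all_boot all_order all_algebra.
From mathcomp Require Import all_fingroup all_solvable all_field all_character.

Set Implicit Arguments.
Unset Strict Implicit.
Unset Printing Implicit Defensive.

Import GroupScope GRing.Theory.
Local Open Scope ring_scope.

Section KGModules.

Variables (k : fieldType) (gT : finGroupType) (G : {group gT}).
Local Notation kGmod := (representation k G).

(** * Homomorphisms of kG-modules *)

Section Homomorphisms.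

Variables M N Q : kGmod.
Implicit Types A B : 'M[k]_(rdegree M, rdegree N).

Lemma kG_hom0 : kG_hom (0 : 'M[k]_(rdegree M, rdegree N)).
Proof. by move=> g _; rewrite mulmx0 mul0mx. Qed.

Lemma kG_hom1 : kG_hom (1%:M : 'M[k]_(rdegree M)).
Proof. by move=> g _; rewrite mulmx1 mul1mx. Qed.

Lemma kG_homD A B : kG_hom A -> kG_hom B -> kG_hom (A + B).
Proof. by move=> hA hB g Gg; rewrite mulmxDr mulmxDl hA ?hB. Qed.

Lemma kG_homB A B : kG_hom A -> kG_hom B -> kG_hom (A - B).
Proof. by move=> hA hB g Gg; rewrite mulmxBr mulmxBl hA ?hB. Qed.

Lemma kG_homM A (B : 'M_(rdegree N, rdegree Q)) :
  kG_hom A -> kG_hom B -> kG_hom (A *m B).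
Proof. by move=> hA hB g Gg; rewrite mulmxA hA // -!mulmxA hB. Qed.

Definition kG_homb A := [forall g in G, M g *m A == A *m N g].

Lemma kG_homP A : reflect (kG_hom A) (kG_homb A).
Proof. by apply: (iffP forall_inP) => hA g /hA => [/eqP | ->]. Qed.

End Homomorphisms.

(** * Norms over subgroups and relative projectivity *)

Definition norm_mx (K : {set gT}) (M : kGmod) : 'M[k]_(rdegree M) :=
  \sum_(u in K) M u.

Lemma norm_mx_hom (K : {set gT}) (M N : kGmod) (A : 'M_(rdegree M, rdegree N)) :
  K \subset G -> kG_hom A -> norm_mx K M *m A = A *m norm_mx K N.
Proof.
move=> /subsetP sKG hA; rewrite mulmx_suml mulmx_sumr.
by apply: eq_bigr => u /sKG /hA.
Qed.

Lemma mul_norm_mx (K : {group gT}) (M : kGmod) u :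
  K \subset G -> u \in K -> M u *m norm_mx K M = norm_mx K M.
Proof.
move=> /subsetP sKG Ku; rewrite [RHS](reindex_inj (mulgI u)) mulmx_sumr.
by apply: eq_big => [v | v Kv]; rewrite ?groupMl ?repr_mxM ?sKG.
Qed.

Lemma norm_mx_mul (K : {group gT}) (M : kGmod) u :
  K \subset G -> u \in K -> norm_mx K M *m M u = norm_mx K M.
Proof.
move=> /subsetP sKG Ku; rewrite [RHS](reindex_inj (mulIg u)) mulmx_suml.
by apply: eq_big => [v | v Kv]; rewrite ?groupMr ?repr_mxM ?sKG.
Qed.

Lemma norm_mx_dprod (H K E : {group gT}) (M : kGmod) :
  H \x K = E -> E \subset G -> norm_mx E M = norm_mx K M *m norm_mx H M.
Proof.
move=> /dprodP[_ defE cHK tiHK] /subsetP sEG.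
have KHE : (K * H)%g = E by rewrite -defE; apply/esym/normC/cents_norm; rewrite centsC.
have KE v : v \in K -> v \in G.
  by move=> Kv; rewrite sEG // -defE -[v]mul1g mem_mulg.
have HE v : v \in H -> v \in G.
  by move=> Hv; rewrite sEG // -defE -[v]mulg1 mem_mulg.
rewrite mulmx_suml; under eq_bigr do rewrite mulmx_sumr.
rewrite pair_big /=.
rewrite /norm_mx (reindex_onto (fun ab => ab.1 * ab.2)%g
  (fun u => (divgr K H u, remgr K H u))) => [|u _] /=; last by rewrite -divgr_eq.
apply: eq_big => [[b a] | [b a]] /=.
  apply/andP/andP => [[Eba /eqP[eb ea]] | [Kb Ha]].
    by split; [rewrite -eb mem_divgr | rewrite -ea mem_remgr]; rewrite ?KHE.
  by rewrite -KHE mem_mulg // divgrMid 1?setIC // remgrMid 1?setIC.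
case/andP => Eba /eqP[eb ea].
have Kb : b \in K by rewrite -eb mem_divgr ?KHE.
have Ha : a \in H by rewrite -ea mem_remgr ?KHE.
by rewrite repr_mxM ?(KE b) ?(HE a).
Qed.

(* Higman's criterion for relative projectivity: the identity is a trace. *)
Definition higman (K : {set gT}) (M : kGmod) : Prop :=
  exists lam : 'M[k]_(rdegree M),
    \sum_(u in K) M u *m lam *m M u^-1%g = 1%:M.

(** Every element of G is uniquely [u * t] with u in K and t a chosen right coset representative, so
    the sum over G splits into the K-trace of the sum of the t-conjugates of [lam]. *)
Lemma higman_sub (K : {group gT}) (M : kGmod) :
  K \subset G -> higman G M -> higman K M.
Proof.
move=> sKG [lam lam1].
exists (\sum_(A in rcosets K G) M (repr A) *m lam *m M (repr A)^-1%g).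
rewrite -[RHS]lam1 (set_partition_big _ (rcosets_partition sKG)) /=.
under eq_bigr do rewrite mulmx_sumr mulmx_suml.
rewrite exchange_big /=; apply: eq_bigr => _ /rcosetsP[x Gx ->].
have [y Ky ->] : exists2 y, y \in K & repr (K :* x) = (y * x)%g.
  by apply/rcosetP; apply: mem_repr_rcoset.
have -> : K :* x = K :* (y * x) by rewrite rcosetM (rcoset_id Ky).
have {}Gx : (y * x)%g \in G by rewrite groupM // (subsetP sKG).
move: (y * x)%g Gx => t Gt.
rewrite [RHS](reindex_inj (mulIg t)) /=.
apply: eq_big => [u | u Ku]; first by rewrite mem_rcoset mulgK.
have Gu := subsetP sKG u Ku.
by rewrite invMg !repr_mxM ?groupV // !mulmxA.
Qed.

(** Vanishing of Tate cohomology in degree 0: inserting the trace after v, each factor [M u] is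
    absorbed by v, which leaves [v *m lam] times the norm. *)
Lemma higman_fixed (K : {group gT}) (M : kGmod) m (v : 'M_(m, rdegree M)) :
  higman K M -> (forall u, u \in K -> v *m M u = v) ->
  (v <= norm_mx K M)%MS.
Proof.
move=> [lam lam1] fix_v; rewrite -[v]mulmx1 -lam1 mulmx_sumr.
rewrite (reindex_inj invg_inj) /= /norm_mx.
suff -> : \sum_(u | u^-1%g \in K) v *m (M u^-1%g *m lam *m M u^-1^-1%g)
        = v *m lam *m norm_mx K M by apply: submxMl.
rewrite mulmx_sumr; apply: eq_big => [u | u Ku]; first by rewrite groupV.
by rewrite invgK !mulmxA fix_v.
Qed.

(** Vanishing of Tate cohomology in degree -1. As v has norm 0, [M u^-1] in the trace may be
    replaced by [M u^-1 - 1], so v is a sum of vectors in the images of the [M u - 1]. *)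
Lemma higman_norm0 (K : {group gT}) (M : kGmod) m (v : 'M_(m, rdegree M)) q
    (B : 'M_(rdegree M, q)) r (W : 'M_(r, q)) :
    higman K M -> v *m norm_mx K M = 0 ->
    (forall u, u \in K -> ((M u - 1%:M) *m B <= W)%MS) ->
  (v *m B <= W)%MS.
Proof.
move=> [lam lam1] Nv0 subW; rewrite -[v]mulmx1 -lam1.
have -> : v *m (\sum_(u in K) M u *m lam *m M u^-1%g)
        = \sum_(u in K) v *m M u *m lam *m (M u^-1%g - 1%:M).
  under [RHS]eq_bigr do rewrite mulmxBr mulmx1.
  rewrite sumrB -!mulmx_suml -mulmx_sumr Nv0 mul0mx subr0 mulmx_sumr.
  by apply: eq_bigr => u _; rewrite !mulmxA.
rewrite mulmx_suml; apply: summx_sub => u Ku; rewrite -mulmxA.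
by apply: submx_trans (submxMl _ _) (subW _ _); rewrite groupV.
Qed.

(** Injectivity of P, for maps f that need not be injective: b factors through f linearly because it
    vanishes on the kernel of f, and averaging this factor against [lam] makes it equivariant. *)
Lemma higman_injective (C D P : kGmod) (f : 'M_(rdegree C, rdegree D))
    (b : 'M_(rdegree C, rdegree P)) :
    kG_hom f -> kG_hom b -> higman G P -> (kermx f <= kermx b)%MS ->
  exists2 g : 'M_(rdegree D, rdegree P), kG_hom g & f *m g = b.
Proof.
move=> hf hb [lam lam1] /sub_kermxP kfb.
have [g0 fg0] : exists g0, f *m g0 = b.
  exists (pinvmx f *m b); rewrite mulmxA; apply/eqP; rewrite -subr_eq0.
  rewrite -[X in _ - X]mul1mx -mulmxBl.
  have : (f *m pinvmx f - 1%:M <= kermx f)%MS.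
    by apply/sub_kermxP; rewrite mulmxBl mul1mx mulmxKpV ?subrr.
  by case/submxP=> D' ->; rewrite -mulmxA kfb mulmx0.
exists (\sum_(u in G) D u *m g0 *m lam *m P u^-1%g) => [x Gx|].
  rewrite mulmx_sumr mulmx_suml [RHS](reindex_inj (mulgI x)) /=.
  apply: eq_big => [u | u Gu]; first by rewrite groupMl.
  by rewrite invMg !repr_mxM ?groupV // !mulmxA repr_mxKV.
rewrite mulmx_sumr -[RHS]mulmx1 -lam1 mulmx_sumr.
by apply: eq_bigr => u Gu; rewrite !mulmxA -hf // -(mulmxA _ f) fg0 hb.
Qed.

(** * Free modules, and Higman's criterion for projectives *)

Local Notation nG := #|pred_of_set (gval G)|.
Local Notation idx := (gring_index G).

Lemma mul_vec_lin_mulmxr m n p (A : 'M[k]_(m, n)) (B : 'M_(n, p)) :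
  mxvec A *m lin_mulmxr B = mxvec (A *m B).
Proof. exact: mul_vec_lin. Qed.

(* The free module k^n (x) kG: an n x #|G| matrix A stands for the sum over g
   of (column g of A) (x) g. *)
Lemma free_mx_repr n :
  mx_repr G (fun g => lin_mulmxr (regular_mx k G g) : 'M[k]_(n * nG)).
Proof.
have [R1 RM] := regular_mx_repr k G; split=> [|g h Gg Gh];
  apply/row_matrixP=> i; rewrite !rowE -[delta_mx 0 i]vec_mxK.
  by rewrite mul_vec_lin_mulmxr R1 !mulmx1.
by rewrite !mulmxA !mul_vec_lin_mulmxr RM // mulmxA.
Qed.

Definition free_module n : kGmod :=
  Representation (MxRepresentation (free_mx_repr n)).

Lemma free_moduleE n g (A : 'M_(n, nG)) :
  mxvec A *m free_module n g = mxvec (A *m regular_mx k G g).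
Proof. exact: mul_vec_lin_mulmxr. Qed.

Lemma col_regular n (A : 'M_(n, nG)) g i : g \in G ->
  col (idx (enum_val i * g)%g) (A *m regular_mx k G g) = col i A.
Proof.
move=> Gg; have Gi j : enum_val j \in G := enum_valP j.
apply/colP=> r; rewrite !mxE (bigD1 i) //= big1 => [|j j'i]; rewrite !mxE /=.
  by rewrite eqxx mulr1 addr0.
case: eqP => [/(congr1 enum_val)|_]; last by rewrite mulr0.
rewrite !gring_indexK ?groupM // => /mulIg/enum_val_inj ij.
by rewrite ij eqxx in j'i.
Qed.

(** The multiplication map from P (x) kG to P, sending v (x) g to v g; columns are transposed
    because module elements are row vectors. *)
Definition action_fun (P : kGmod) (v : 'rV[k]_(rdegree P * nG)) : 'rV_(rdegree P) :=
  \sum_j (col j (vec_mx v))^T *m P (enum_val j).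

Lemma action_fun_is_linear (P : kGmod) : linear (@action_fun P).
Proof.
move=> a u v; rewrite /action_fun scaler_sumr -big_split /=.
by apply: eq_bigr => j _; rewrite linearP /= !linearP /= mulmxDl -scalemxAl.
Qed.

HB.instance Definition _ (P : kGmod) :=
  GRing.isLinear.Build k 'rV_(rdegree P * nG) 'rV_(rdegree P) _ _
    (@action_fun_is_linear P).

Definition action_mx (P : kGmod) : 'M_(rdegree (free_module (rdegree P)), rdegree P) :=
  lin1_mx (@action_fun P).

Lemma action_mxE (P : kGmod) A :
  mxvec A *m action_mx P = \sum_j (col j A)^T *m P (enum_val j).
Proof. by rewrite mul_rV_lin1 /= /action_fun mxvecK. Qed.

Lemma action_mx_hom P : kG_hom (action_mx P).
Proof.
move=> g Gg; apply/row_matrixP=> i; rewrite !rowE -[delta_mx 0 i]vec_mxK !mulmxA.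
rewrite free_moduleE !action_mxE mulmx_suml.
have reg_inj : injective (fun i : 'I_nG => idx (enum_val i * g)%g).
  move=> i1 i2 eq_i; have := congr1 enum_val eq_i.
  rewrite !gring_indexK ?groupM ?enum_valP // => /mulIg.
  exact: enum_val_inj.
rewrite (reindex_inj reg_inj) /=; apply: eq_bigr => j _.
rewrite col_regular // gring_indexK ?groupM ?enum_valP //.
by rewrite -mulmxA repr_mxM ?enum_valP.
Qed.

Lemma action_mx_full P : row_full (action_mx P).
Proof.
rewrite -sub1mx; apply/row_subP=> i; set v := row i _.
(* The preimage of v is v (x) 1. *)
suff -> : v = mxvec (v^T *m delta_mx 0 (idx 1)) *m action_mx P by apply: submxMl.
rewrite action_mxE (bigD1 (idx 1)) //= big1 => [|j j'1].
  rewrite gring_indexK // repr_mx1 mulmx1 addr0 colE -mulmxA mul_delta_mx.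
  by rewrite [delta_mx 0 0]mx11_scalar mxE !eqxx mulmx1 trmxK.
rewrite colE -mulmxA mul_delta_mx_cond eq_sym (negPf j'1) mulr0n.
by rewrite mulmx0 trmx0 mul0mx.
Qed.

(** Here [lam] is the projection onto k^n (x) 1; its conjugate by u is the projection onto k^n (x)
    u^-1, and these add up to the identity. *)
Lemma free_higman n : higman G (free_module n).
Proof.
exists (lin_mulmxr (delta_mx (idx 1) (idx 1))).
apply/row_matrixP=> i; rewrite !rowE -[delta_mx 0 i]vec_mxK mulmx1.
move: (vec_mx _) => A; rewrite mulmx_sumr.
have regE u : u \in G -> mxvec A *m (free_module n u
      *m lin_mulmxr (delta_mx (idx 1) (idx 1)) *m free_module n u^-1%g)
    = mxvec (A *m delta_mx (idx u^-1%g) (idx u^-1%g)).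
  move=> Gu; rewrite !mulmxA free_moduleE mul_vec_lin_mulmxr free_moduleE -!mulmxA.
  congr (mxvec (A *m _)); rewrite -(mul_delta_mx (0 : 'I_1)) -!mulmxA -rowE.
  rewrite rowK gring_indexK // mul1g.
  rewrite -[RHS](mul_delta_mx (0 : 'I_1)) mulmxA; congr (_ *m _).
  apply/colP=> j; rewrite -colE !mxE.
  rewrite eqxx andbT /=; congr (_%:R).
  rewrite -!(inj_eq (can_inj (@gring_valK _ G))) !gring_indexK
    ?groupV ?groupM ?enum_valP //.
  by rewrite eq_sym [enum_val j == _]eq_mulgV1 invgK.
rewrite (eq_bigr _ regE) -linear_sum -mulmx_sumr; congr mxvec.
rewrite (reindex_inj invg_inj) /=.
rewrite -[RHS]mulmx1 [1%:M]mx1_sum_delta.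
rewrite (reindex_onto (@enum_val _ G) idx) => [|u].
  congr (_ *m _); apply: eq_big => j; first by rewrite groupV enum_valP gring_valK eqxx.
  by rewrite invgK gring_valK.
by rewrite groupV => /gring_indexK.
Qed.

(** Projectivity gives a section h of the multiplication map, and the trace witness of the free
    module is compressed to P along h and that map. *)
Lemma projective_higman (P : kGmod) : projective P -> higman G P.
Proof.
move=> projP; have [lam lam1] := free_higman (rdegree P).
have hq := @action_mx_hom P.
have [h hh hq1] := projP _ _ _ _ hq (action_mx_full P) (@kG_hom1 P).
exists (h *m lam *m action_mx P).
rewrite -hq1 -[h in RHS]mulmx1 -lam1 mulmx_sumr mulmx_suml.
apply: eq_bigr => u Gu; rewrite !mulmxA hh // -!mulmxA.
by rewrite -hq ?groupV.
Qed.

(** * Diagonal modules, and their sums with projectives *)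

Definition diagonal_rep (L : kGmod) : Prop :=
  forall g, g \in G -> is_diag_mx (L g).

Lemma diagonal_repE (L : kGmod) g i j :
  diagonal_rep L -> g \in G -> L g i j = L g i i *+ (i == j).
Proof.
move=> dL Gg; case: eqP => [<- // | /eqP ij].
by move/is_diag_mxP: (dL g Gg) => ->.
Qed.

(* Replacing B0 by its part supported on pairs of equal characters does not
   change A *m B0 *m A, as A itself is supported on such pairs. *)
Lemma diagonal_ginv (L L' : kGmod) (A : 'M_(rdegree L, rdegree L')) :
    diagonal_rep L -> diagonal_rep L' -> kG_hom A ->
  exists B : 'M_(rdegree L', rdegree L),
    [/\ kG_hom B, A *m B *m A = A & B *m A *m B = B].
Proof.
move=> dL dL' hA.
pose same i j := [forall g in G, L g i i == L' g j j].
have A0 i j : ~~ same i j -> A i j = 0.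
  move=> /forall_inPn[g Gg neq_g].
  have /matrixP/(_ i j) := hA g Gg; rewrite !mxE.
  under eq_bigr do rewrite diagonal_repE // mulrnAl mulrb.
  under [RHS]eq_bigr do rewrite diagonal_repE // mulrnAr mulrb.
  rewrite -!big_mkcond /= (big_pred1 i) => [|l]; last by rewrite eq_sym.
  rewrite (big_pred1 j) // mulrC => /eqP; rewrite -subr_eq0 -mulrBr mulf_eq0.
  by rewrite subr_eq0 (negPf neq_g) orbF => /eqP.
pose B0 := pinvmx A.
have AB0A : A *m B0 *m A = A by apply: mulmxKpV.
pose B1 := \matrix_(j, i) (B0 j i *+ same i j).
have hB1 : kG_hom B1.
  move=> g Gg; apply/matrixP=> j i; rewrite !mxE.
  under eq_bigr do rewrite diagonal_repE // mulrnAl mulrb.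
  under [RHS]eq_bigr do rewrite diagonal_repE // mulrnAr mulrb.
  rewrite -!big_mkcond /= (big_pred1 j) => [|l]; last by rewrite eq_sym.
  rewrite (big_pred1 i) // !mxE mulrC.
  case: (boolP (same i j)) => [/forall_inP/(_ g Gg)/eqP -> //|_].
  by rewrite mulr0n !mul0r.
have AB1A : A *m B1 *m A = A.
  apply/matrixP=> i l; case: (boolP (same i l)) => [Sil|]; last first.
    move=> nSil; rewrite [RHS]A0 // mxE big1 // => i' _.
    case: (boolP (same i' l)) => [Si'l | /A0->]; last by rewrite mulr0.
    rewrite mxE big1 ?mul0r // => j _.
    case: (boolP (same i j)) => [Sij | /A0->]; last by rewrite mul0r.
    rewrite mxE; case: (boolP (same i' j)) => [Si'j|_]; last by rewrite mulr0n mulr0.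
    case/negP: nSil; apply/forall_inP=> g Gg.
    rewrite (eqP (forall_inP Sij g Gg)) -(eqP (forall_inP Si'j g Gg)).
    exact: (forall_inP Si'l g Gg).
  rewrite -[in RHS]AB0A !mxE; apply: eq_bigr => i' _; rewrite !mxE.
  case: (boolP (same i' l)) => [Si'l | /A0->]; last by rewrite !mulr0.
  congr (_ * _); apply: eq_bigr => j _; rewrite mxE.
  case: (boolP (same i j)) => [Sij | /A0->]; last by rewrite !mul0r.
  suff -> : same i' j by [].
  apply/forall_inP=> g Gg; rewrite (eqP (forall_inP Si'l g Gg)).
  by rewrite -(eqP (forall_inP Sil g Gg)) (forall_inP Sij g Gg).
(* Any B1 with [A *m B1 *m A = A] yields in this way an inverse that satisfies both equations. *)
exists (B1 *m A *m B1); split.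
- by apply: kG_homM => //; apply: kG_homM.
- by rewrite !mulmxA AB1A AB1A.
by rewrite !mulmxA -2!(mulmxA _ _ A) -(mulmxA B1) !mulmxA -!(mulmxA B1) !AB1A.
Qed.

(** The equation [bi_sum] exhibits M as a retract of the direct sum of L and P. *)
Record biproduct (M L P : kGmod) := Biproduct {
  bi_inl : 'M[k]_(rdegree L, rdegree M);
  bi_outl : 'M[k]_(rdegree M, rdegree L);
  bi_inr : 'M[k]_(rdegree P, rdegree M);
  bi_outr : 'M[k]_(rdegree M, rdegree P);
  bi_inl_hom : kG_hom bi_inl;
  bi_outl_hom : kG_hom bi_outl;
  bi_inr_hom : kG_hom bi_inr;
  bi_outr_hom : kG_hom bi_outr;
  bi_sum : bi_outl *m bi_inl + bi_outr *m bi_inr = 1%:M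
}.

Definition diag_plus_higman (M : kGmod) : Prop :=
  exists L P : kGmod, [/\ diagonal_rep L, higman G P & inhabited (biproduct M L P)].

Lemma diagonal0 : diagonal_rep (grepr0 : kGmod).
Proof. by move=> g _; apply: scalar_mx_is_diag. Qed.

Lemma higman0 : higman G (grepr0 : kGmod).
Proof. by exists 0; apply/matrixP=> -[]. Qed.

Lemma rdegree0_diag_plus_higman (M : kGmod) :
  rdegree M = 0%N -> diag_plus_higman M.
Proof.
move=> M0; exists grepr0, grepr0; split; [exact: diagonal0 | exact: higman0 |].
split; apply: (@Biproduct _ _ _ 0 0 0 0); try exact: kG_hom0.
by apply/matrixP=> i; have := ltn_ord i; rewrite [X in (_ < X)%N]M0.
Qed.

Lemma diagonal_diag_plus_higman (M : kGmod) :
  diagonal_rep M -> diag_plus_higman M.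
Proof.
move=> dM; exists M, grepr0; split=> //; first exact: higman0.
split; apply: (@Biproduct _ _ _ 1%:M 1%:M 0 0);
  try exact: kG_hom0; try exact: kG_hom1.
by rewrite mulmx1 mulmx0 addr0.
Qed.

Lemma higman_diag_plus_higman (M : kGmod) :
  higman G M -> diag_plus_higman M.
Proof.
move=> pM; exists grepr0, M; split=> //; first exact: diagonal0.
split; apply: (@Biproduct _ _ _ 0 0 1%:M 1%:M);
  try exact: kG_hom0; try exact: kG_hom1.
by rewrite mulmx1 mulmx0 add0r.
Qed.

Lemma diag_plus_higman_rsim (M N : kGmod) :
  mx_rsim M N -> diag_plus_higman N -> diag_plus_higman M.
Proof.
move=> [B degMN freeB hB] [L [P [dL pP [[iL pL iP pP' hiL hpL hiP hpP sumN]]]]].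
have [B' BB'] := row_freeP freeB.
have B'B : B' *m B = 1%:M.
  (* The equality of the two degrees is eliminated so that B becomes a square matrix, whose right
     inverse is also a left inverse. *)
  by case: M N degMN B {freeB} hB iL pL iP pP' hiL hpL hiP hpP sumN B' BB'
    => m M [n N] /= mn; case: _ / mn in N * => B *; apply: mulmx1C.
have hB' : kG_hom (B' : 'M_(rdegree N, rdegree M)).
  move=> g Gg; rewrite -[_ *m B']mul1mx -B'B -!mulmxA; congr (_ *m _).
  by rewrite !mulmxA -hB // -[RHS]mulmx1 -!mulmxA BB' !mulmx1.
exists L, P; split=> //.
split; apply: (@Biproduct _ _ _ (iL *m B') (B *m pL) (iP *m B') (B *m pP'));
  try exact: kG_homM.
by rewrite !mulmxA -mulmxDl -!(mulmxA B) -mulmxDr sumN mulmx1.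
Qed.

Lemma kG_hom_dadd (M1 M2 N1 N2 : kGmod) (A1 : 'M_(rdegree M1, rdegree N1))
    (A2 : 'M_(rdegree M2, rdegree N2)) :
  kG_hom A1 -> kG_hom A2 ->
  kG_hom (block_mx A1 0 0 A2 :
    'M_(rdegree (dadd_grepr M1 M2), rdegree (dadd_grepr N1 N2))).
Proof.
move=> h1 h2 g Gg /=; rewrite !mulmx_block !mulmx0 !mul0mx !addr0 !add0r.
by rewrite h1 ?h2.
Qed.

Lemma diagonal_dadd (L1 L2 : kGmod) :
  diagonal_rep L1 -> diagonal_rep L2 -> diagonal_rep (dadd_grepr L1 L2).
Proof. by move=> d1 d2 g Gg; rewrite /= is_diag_block_mx // !eqxx d1 ?d2. Qed.

Lemma higman_dadd (P1 P2 : kGmod) :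
  higman G P1 -> higman G P2 -> higman G (dadd_grepr P1 P2).
Proof.
move=> [l1 e1] [l2 e2]; exists (block_mx l1 0 0 l2) => /=.
under eq_bigr do rewrite !mulmx_block !(mulmx0, mul0mx) !addr0 !add0r.
rewrite [RHS]scalar_mx_block -e1 -e2.
elim/big_rec3: _ => [|u A1 A2 A _ ->]; first by rewrite block_mx0.
by rewrite add_block_mx !addr0; congr block_mx; apply: mul0mx.
Qed.

Lemma diag_plus_higman_dadd (M1 M2 : kGmod) :
  diag_plus_higman M1 -> diag_plus_higman M2 ->
  diag_plus_higman (dadd_grepr M1 M2).
Proof.
move=> [L1 [P1 [dL1 pP1 [[iL1 pL1 iP1 oP1 hiL1 hpL1 hiP1 hoP1 sum1]]]]].
move=> [L2 [P2 [dL2 pP2 [[iL2 pL2 iP2 oP2 hiL2 hpL2 hiP2 hoP2 sum2]]]]].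
exists (dadd_grepr L1 L2), (dadd_grepr P1 P2); split.
- exact: diagonal_dadd.
- exact: higman_dadd.
split; apply: (@Biproduct (dadd_grepr M1 M2) (dadd_grepr L1 L2) (dadd_grepr P1 P2)
  (block_mx iL1 0 0 iL2) (block_mx pL1 0 0 pL2)
  (block_mx iP1 0 0 iP2) (block_mx oP1 0 0 oP2)); try exact: kG_hom_dadd.
rewrite /= !mulmx_block !mulmx0 !mul0mx !addr0 !add0r add_block_mx sum1 sum2.
by rewrite [RHS]scalar_mx_block; congr block_mx; apply: addr0.
Qed.

End KGModules.

(** * Restriction to the elementary abelian subgroup of rank two *)

Section RankTwo.

Variables (k : fieldType) (gT : finGroupType) (G H K E : {group gT}) (p : nat).
Variable g : gT.
Local Notation kGmod := (representation k G).

Hypotheses (pchark : p \in [pchar k]) (sEG : E \subset G) (abelE : p.-abelem E).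
Hypotheses (defE : H \x K = E) (defH : <[g]> = H) (oH : #|H| = p) (oK : #|K| = p).

Local Notation Xg M := ((M : kGmod) g - 1%:M).
Local Notation NH M := (norm_mx H (M : kGmod)).
Local Notation NK M := (norm_mx K (M : kGmod)).

Let sHE : H \subset E. Proof. by case/dprodP: defE => _ <- _ _; apply: mulG_subl. Qed.
Let sKE : K \subset E. Proof. by case/dprodP: defE => _ <- _ _; apply: mulG_subr. Qed.
Let sHG : H \subset G := subset_trans sHE sEG.
Let sKG : K \subset G := subset_trans sKE sEG.
Let Hg : g \in H. Proof. by rewrite -defH cycle_id. Qed.
Let Gg : g \in G := subsetP sHG g Hg.
Let cEE : abelian E := abelem_abelian abelE.

(** A diagonal entry x of [L u] satisfies x^p = 1, and in characteristic p this reads (x - 1)^p = 0,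
    so x = 1. *)
Lemma diagonal_rep_trivial (L : kGmod) u : diagonal_rep L -> u \in E -> L u = 1%:M.
Proof.
move=> dL Eu; have Gu := subsetP sEG u Eu.
apply/matrixP=> i j; rewrite diagonal_repE // !mxE; congr (_ *+ _).
have powL n : L (u ^+ n)%g i i = L u i i ^+ n.
  elim: n => [|n IHn]; first by rewrite expg0 repr_mx1 mxE eqxx.
  rewrite expgS repr_mxM ?groupX // mxE (bigD1 i) //= big1 ?addr0 ?exprS ?IHn //.
  by move=> l l'i; rewrite diagonal_repE // eq_sym (negPf l'i) mul0r.
have up1 : (u ^+ p = 1)%g by have [_ _ /exponentP->] := and3P abelE.
have /eqP : (L u i i - 1) ^+ p = 0.
  rewrite -(pFrobenius_autE pchark) rmorphB rmorph1 /= pFrobenius_autE -powL up1.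
  by rewrite repr_mx1 mxE eqxx subrr.
by rewrite expf_eq0 subr_eq0 => /andP[_ /eqP].
Qed.

Lemma norm_diagonal (L : kGmod) (Q : {set gT}) :
  diagonal_rep L -> Q \subset E -> (p %| #|Q|)%N -> norm_mx Q L = 0.
Proof.
move=> dL sQE /dvdnP[q oQ]; rewrite /norm_mx (eq_bigr (fun _ => 1%:M)).
  by rewrite sumr_const oQ -scaler_nat natrM (pcharf0 pchark) mulr0 scale0r.
by move=> u Qu; rewrite diagonal_rep_trivial // (subsetP sQE).
Qed.

Lemma sub1_hom (M N : kGmod) (A : 'M_(rdegree M, rdegree N)) :
  kG_hom A -> Xg M *m A = A *m Xg N.
Proof. by move=> hA; rewrite mulmxBl mulmxBr mulmx1 mul1mx hA. Qed.

Lemma cycle_sub1_submx (M : kGmod) u : u \in H -> (M u - 1%:M <= Xg M)%MS.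
Proof.
rewrite -defH => /cycleP[n ->]; elim: n => [|n IHn].
  by rewrite expg0 repr_mx1 subrr sub0mx.
have -> : M (g ^+ n.+1)%g - 1%:M = M (g ^+ n)%g *m Xg M + (M (g ^+ n)%g - 1%:M).
  by rewrite expgSr repr_mxM ?groupX // mulmxBr mulmx1 subrKA.
by rewrite addmx_sub // submxMl.
Qed.

Lemma norm_mx_commutes (M : kGmod) u : u \in E -> M u *m NK M = NK M *m M u.
Proof.
move=> Eu; rewrite /norm_mx mulmx_sumr mulmx_suml; apply: eq_bigr => v Kv.
have Ev := subsetP sKE v Kv.
by rewrite -!repr_mxM ?(subsetP sEG) // (centsP cEE).
Qed.

Lemma sub1_mul_norm (M : kGmod) : Xg M *m NH M = 0.
Proof. by rewrite mulmxBl mul1mx mul_norm_mx ?subrr. Qed.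

Lemma norm_mul_sub1 (M : kGmod) : NH M *m Xg M = 0.
Proof. by rewrite mulmxBr mulmx1 norm_mx_mul ?subrr. Qed.

Lemma sub1_norm_commutes (M : kGmod) : Xg M *m NK M = NK M *m Xg M.
Proof. by rewrite mulmxBl mulmxBr mulmx1 mul1mx norm_mx_commutes // (subsetP sHE). Qed.

Lemma ker_sub1_fixed (M : kGmod) m (w : 'M_(m, rdegree M)) u :
  w *m Xg M = 0 -> u \in H -> w *m M u = w.
Proof.
move=> wX0 Hu; suff: u \in rstab M w by rewrite inE => /andP[_ /eqP].
suff: <[g]> \subset rstab M w by move/subsetP->; rewrite ?defH.
by rewrite cycle_subG inE Gg -subr_eq0 -{2}[w]mulmx1 -mulmxBr wX0 eqxx.
Qed.

(** The vector w is fixed by K, being a K-norm, and by g, hence by all of E; so it is an E-norm. *)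
Lemma higman_ker_sub1 (P : kGmod) m (w : 'M_(m, rdegree P)) :
    higman G P -> (w <= NK P)%MS -> w *m Xg P = 0 ->
  (w <= NK P *m NH P)%MS.
Proof.
move=> pP /submxP[c ->] wX0; rewrite -(norm_mx_dprod _ defE sEG).
apply: higman_fixed (higman_sub sEG pP) _ => u.
case/dprodP: (defE) => _ <- _ _ /mulsgP[a b Ha Kb ->].
rewrite repr_mxM ?(subsetP sHG a) ?(subsetP sKG b) // mulmxA (ker_sub1_fixed wX0 Ha).
by rewrite -mulmxA norm_mx_mul.
Qed.

(** If w = c N_K, then c has E-norm 0. For a in H and b in K, (a b - 1) N_K = (a - 1) N_K, and a - 1
    is a multiple of g - 1. *)
Lemma higman_ker_norm (P : kGmod) m (w : 'M_(m, rdegree P)) :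
    higman G P -> (w <= NK P)%MS -> w *m NH P = 0 ->
  (w <= NK P *m Xg P)%MS.
Proof.
move=> pP /submxP[c ->]; rewrite -mulmxA -(norm_mx_dprod _ defE sEG) => cN0.
apply: (higman_norm0 (higman_sub sEG pP) cN0) => u.
case/dprodP: (defE) => _ <- _ _ /mulsgP[a b Ha Kb ->].
rewrite repr_mxM ?(subsetP sHG a) ?(subsetP sKG b) // mulmxBl mul1mx -mulmxA.
rewrite mul_norm_mx // -[X in _ - X]mul1mx -mulmxBl -sub1_norm_commutes.
exact: submxMr (cycle_sub1_submx _ _).
Qed.

(** * Kernels of N_H and g - 1 on the K-norms of a decomposed module *)

Section Module.

Variables (M L P : kGmod) (bM : biproduct M L P).
Hypotheses (dL : diagonal_rep L) (pP : higman G P).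

(** N_K vanishes on L because K acts trivially there and p divides its order; so K-norms in M are
    recovered from their P-components. *)
Let NK_outr m (w : 'M_(m, rdegree M)) :
  (w <= NK M)%MS -> w = w *m bi_outr bM *m bi_inr bM.
Proof.
case/submxP=> c ->; rewrite -[LHS]mulmx1 -(bi_sum bM) mulmxDr.
rewrite -!mulmxA (mulmxA (NK M) (bi_outl bM)) (norm_mx_hom sKG (bi_outl_hom bM)).
by rewrite (norm_diagonal dL sKE) ?oK // mulmx0 mul0mx mulmx0 add0r.
Qed.

Let NK_sub m (w : 'M_(m, rdegree M)) :
  (w <= NK M)%MS -> (w *m bi_outr bM <= NK P)%MS.
Proof.
case/submxP=> c ->; rewrite -mulmxA (norm_mx_hom sKG (bi_outr_hom bM)) mulmxA.
exact: submxMl.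
Qed.

Lemma ker_sub1_submx_norm m (w : 'M_(m, rdegree M)) :
  (w <= NK M)%MS -> w *m Xg M = 0 -> (w <= NK M *m NH M)%MS.
Proof.
move=> Kw wX0; have [hi ho] := (bi_inr_hom bM, bi_outr_hom bM).
have woX0 : w *m bi_outr bM *m Xg P = 0.
  by rewrite -mulmxA -(sub1_hom ho) mulmxA wX0 mul0mx.
have := submxMr (bi_inr bM) (higman_ker_sub1 pP (NK_sub Kw) woX0).
rewrite -NK_outr // -mulmxA (norm_mx_hom sHG hi) mulmxA (norm_mx_hom sKG hi).
by move/submx_trans; apply; rewrite -mulmxA submxMl.
Qed.

Lemma ker_norm_submx_sub1 m (w : 'M_(m, rdegree M)) :
  (w <= NK M)%MS -> w *m NH M = 0 -> (w <= NK M *m Xg M)%MS.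
Proof.
move=> Kw wN0; have [hi ho] := (bi_inr_hom bM, bi_outr_hom bM).
have woN0 : w *m bi_outr bM *m NH P = 0.
  by rewrite -mulmxA -(norm_mx_hom sHG ho) mulmxA wN0 mul0mx.
have := submxMr (bi_inr bM) (higman_ker_norm pP (NK_sub Kw) woN0).
rewrite -NK_outr // -mulmxA (sub1_hom hi) mulmxA (norm_mx_hom sKG hi).
by move/submx_trans; apply; rewrite -mulmxA submxMl.
Qed.

End Module.

(** * Regularity of a single differential *)

Section Regular.

Variables (M L P N L' P' : kGmod).
Variables (bM : biproduct M L P) (bN : biproduct N L' P').
Hypotheses (dL : diagonal_rep L) (pP : higman G P).
Hypotheses (dL' : diagonal_rep L') (pP' : higman G P').
Variables (d : 'M[k]_(rdegree M, rdegree N)) (rho : 'M[k]_(rdegree M)).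
Hypotheses (hd : kG_hom d) (hrho : kG_hom rho).
Hypotheses (rho_d : rho *m d = 0)
  (rho_id : forall m (z : 'M_(m, rdegree M)), z *m d = 0 -> z *m rho = z).
Hypothesis norm_lift : forall m (w : 'M_(m, rdegree M)),
  (w *m d <= NK N *m NH N)%MS -> exists v, w *m d = v *m d *m NH N.

(** With no L'-component, [w *m d] comes from an E-fixed vector of P', hence is an E-norm, and
    [norm_lift] applies. Then w - v N_H is a cycle, which 1 - [rho] kills; as 1 - [rho] commutes
    with N_H, the witness is v (1 - [rho]). *)
Lemma fixed_lift m (w : 'M_(m, rdegree M)) :
    (forall u, u \in E -> w *m M u = w) -> w *m d *m bi_outl bN = 0 ->
  exists v, w *m (1%:M - rho) = v *m NH M.
Proof.
move=> fix_w wd0; have [hi ho] := (bi_inr_hom bN, bi_outr_hom bN).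
have [|v wd] := @norm_lift _ w.
  have -> : w *m d = w *m d *m bi_outr bN *m bi_inr bN.
    by rewrite -[LHS]mulmx1 -(bi_sum bN) mulmxDr !mulmxA wd0 mul0mx add0r.
  have fix_wd u : u \in E -> w *m d *m bi_outr bN *m P' u = w *m d *m bi_outr bN.
    move=> Eu; have Gu := subsetP sEG u Eu.
    by rewrite -!mulmxA -ho // !mulmxA -(mulmxA w d) -hd // mulmxA fix_w.
  have := submxMr (bi_inr bN) (higman_fixed (higman_sub sEG pP') fix_wd).
  rewrite (norm_mx_hom sEG hi) -(norm_mx_dprod _ defE sEG).
  by move/submx_trans; apply; apply: submxMl.
exists (v *m (1%:M - rho)).
have hpsi : kG_hom (1%:M - rho) by apply: kG_homB => //; apply: kG_hom1.
rewrite -mulmxA -(norm_mx_hom sHG hpsi) mulmxA.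
have : (w - v *m NH M) *m d = 0.
  by rewrite mulmxBl wd -!mulmxA (norm_mx_hom sHG hd) subrr.
move=> /rho_id/eqP; rewrite mulmxBl subr_eq => /eqP w_rho.
apply/eqP; rewrite -subr_eq0 -mulmxBl mulmxBr mulmx1 mulmxBl w_rho addrK.
by rewrite subrr.
Qed.

(* th is an idempotent with the same kernel as c *m d, where c corrects by a
   generalized inverse of the L -> L' component of d. Its L -> L component is
   0, so n squares to 0, th = (th - n) (1 + n) factors
   through P as th - n does, and injectivity of P gives r1 with
   c *m d *m r1 = th. *)
Lemma diff_regular : exists2 r : 'M_(rdegree N, rdegree M), kG_hom r & d *m r *m d = d.
Proof.
have hM1 := @kG_hom1 _ _ _ M; have hN1 := @kG_hom1 _ _ _ N.
have [iL oL iP oP hiL hoL hiP hoP sumM] := bM.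
pose oL' := bi_outl bN; have hoL' : kG_hom oL' := bi_outl_hom bN.
pose alpha := iL *m d *m oL'.
have halpha : kG_hom alpha by apply: kG_homM hoL'; apply: kG_homM.
have [beta [hbeta aba bab]] := diagonal_ginv dL dL' halpha.
pose r0 := oL' *m beta *m iL.
have hr0 : kG_hom r0 by apply: kG_homM hiL; apply: kG_homM.
pose psi := 1%:M - rho; have hpsi : kG_hom psi by apply: kG_homB.
pose c := 1%:M - d *m r0.
have hc : kG_hom c by apply: kG_homB => //; apply: kG_homM.
pose th := c *m psi; have hth : kG_hom th by apply: kG_homM.
have psi_d : psi *m d = d by rewrite mulmxBl mul1mx rho_d subr0.
have psi0 m (z : 'M_(m, rdegree M)) : z *m d = 0 -> z *m psi = 0.
  by move=> /rho_id z_rho; rewrite mulmxBr mulmx1 z_rho subrr.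
have dr0dr0 : d *m r0 *m (d *m r0) = d *m r0.
  transitivity (d *m oL' *m (beta *m alpha *m beta) *m iL).
    by rewrite /r0 /alpha !mulmxA.
  by rewrite bab /r0 !mulmxA.
have cc : c *m c = c.
  by rewrite {2}/c mulmxBr mulmx1 mulmxBl mul1mx dr0dr0 subrr subr0.
have psi_c_psi : psi *m c *m psi = c *m psi.
  apply/eqP; rewrite -subr_eq0 -mulmxBl; apply/eqP/psi0.
  rewrite mulmxBl {1}/c mulmxBr mulmx1 mulmxA psi_d mulmxBl psi_d.
  by rewrite /c mulmxBl mul1mx subrr.
have thth : th *m th = th by rewrite /th -!mulmxA (mulmxA psi) psi_c_psi mulmxA cc.
have thd : th *m d = c *m d by rewrite -mulmxA psi_d.
have th_psi : th *m psi = th.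
  have rho_rho : rho *m rho = rho by apply: rho_id.
  rewrite -mulmxA; congr (_ *m _).
  by rewrite {2}/psi mulmxBr mulmx1 mulmxBl mul1mx rho_rho subrr subr0.
have th_L : iL *m th *m oL = 0.
  (* The rows of [iL *m c] are E-fixed, and their images under d have L'-component
     [alpha - alpha *m beta *m alpha = 0]. So [iL *m th] takes values in H-norms, which vanish in
     L. *)
  have [u Eu|| v wv] := @fixed_lift _ (iL *m c).
  - have Gu := subsetP sEG u Eu.
    rewrite -mulmxA -hc // mulmxA -hiL // diagonal_rep_trivial // mul1mx //.
  - have -> : iL *m c *m d *m oL' = alpha - alpha *m beta *m alpha.
      by rewrite mulmxBr mulmx1 !mulmxBl /r0 /alpha !mulmxA.
    by rewrite aba subrr.
  rewrite /th mulmxA wv -mulmxA (norm_mx_hom sHG hoL).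
  by rewrite (norm_diagonal dL sHE) ?mulmx0 // oH.
clearbody th r0; pose n := th *m oL *m iL *m th; have nn : n *m n = 0.
  transitivity (th *m oL *m (iL *m (th *m th) *m oL) *m iL *m th).
    by rewrite /n !mulmxA.
  by rewrite thth th_L mulmx0 !mul0mx.
have thn : th *m n = n by rewrite /n !mulmxA thth.
have thP : th *m oP *m iP *m th = th - n.
  apply/eqP; rewrite eq_sym subr_eq; apply/eqP.
  rewrite /n -!mulmxA -mulmxDr !mulmxA -mulmxDl addrC sumM mul1mx.
  by rewrite thth.
pose b := th *m oP; pose a := iP *m th *m (1%:M + n).
have hn : kG_hom n by do 2![apply: kG_homM => //]; apply: kG_homM.
have hb : kG_hom b by apply: kG_homM.
have ha : kG_hom a by apply: kG_homM; [apply: kG_homM | apply: kG_homD].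
have ba : b *m a = th.
  rewrite /b /a !mulmxA thP mulmxDr mulmx1 !mulmxBl nn thn.
  by rewrite subr0 subrK.
have hcd : kG_hom (c *m d) by apply: kG_homM.
have [|g1 hg1 g1b] := higman_injective hcd hb pP.
  apply/sub_kermxP; rewrite /b mulmxA -th_psi [_ *m (th *m psi)]mulmxA.
  by rewrite psi0 ?mul0mx // -mulmxA thd mulmx_ker.
pose r1 := g1 *m a; have d1r1 : c *m d *m r1 = th by rewrite mulmxA g1b ba.
have hr1 : kG_hom r1 by apply: kG_homM.
(* Since d = d r0 d + c d, the map r1 only has to invert the second summand: c d r1 c d = th c d = c
   d. *)
exists (r0 + (1%:M - r0 *m d) *m r1 *m c).
  apply: kG_homD => //; apply: kG_homM => //.
  by apply: kG_homM => //; apply: kG_homB => //; apply: kG_homM.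
have dc : d *m (1%:M - r0 *m d) = c *m d.
  by rewrite mulmxBr mulmx1 mulmxBl mul1mx mulmxA.
transitivity (d *m r0 *m d + d *m (1%:M - r0 *m d) *m r1 *m (c *m d)).
  by rewrite mulmxDr mulmxDl !mulmxA.
rewrite dc d1r1 -{1}thd mulmxA thth thd /c mulmxBl mul1mx addrC subrK //.
Qed.

End Regular.

(** * From lifting along the complex to a contraction *)

Section Complex.

Variables (l : nat) (C : cochain_complex k G).
Hypotheses (bndC : bounded_by l C) (exC : exact_complex C).
Hypothesis decC : forall i, diag_plus_higman (C i).
Local Notation d i := (diff C i).

Lemma exact_lift i m (z : 'M_(m, rdegree (C i.+1))) :
  z *m d i.+1 = 0 -> exists v, z = v *m d i.
Proof.
have [_ /(_ i)/andP[kd _]] := exC.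
by move/sub_kermxP/submx_trans/(_ kd)/submxP.
Qed.

(* The two claims are proved together by descending induction on j, each one
   in degree j using the other one in degree j.+1. *)
Lemma norm_cycles j m (w : 'M_(m, rdegree (C j))) : (w <= NK (C j))%MS ->
  (w *m NH (C j) *m d j = 0 ->
     exists2 z, z *m d j = 0 & w *m NH (C j) = z *m NH (C j)) /\
  (w *m Xg (C j) *m d j = 0 ->
     exists2 z, z *m d j = 0 & w *m Xg (C j) = z *m Xg (C j)).
Proof.
have [n le_n] := ubnP (l.+1 - j)%N.
elim: n => // n IHn in j m w le_n *; move=> Kw.
(* Beyond degree l the terms are zero, which ends the recursion. *)
have [lt_lj | le_jl] := ltnP l j.
  suff w0 : w = 0 by split=> _; exists 0; rewrite ?w0 !mul0mx.
  apply/matrixP=> i i'; have := ltn_ord i'.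
  by rewrite [X in (_ < X)%N](bndC lt_lj).
have hd := diff_hom C j; have [L [P [dL pP [bM]]]] := decC j.+1.
have Kwd : (w *m d j <= NK (C j.+1))%MS.
  case/submxP: Kw => c ->; rewrite -mulmxA (norm_mx_hom sKG hd) mulmxA.
  exact: submxMl.
have lt_n : (l.+1 - j.+1 < n)%N by rewrite subSS -subSn.
have XdN (A : 'M_(m, _)) : A *m Xg (C j) *m d j = A *m d j *m Xg (C j.+1).
  by rewrite -!mulmxA (sub1_hom hd).
have NdX (A : 'M_(m, _)) : A *m NH (C j) *m d j = A *m d j *m NH (C j.+1).
  by rewrite -!mulmxA (norm_mx_hom sHG hd).
split=> wd0.
(* Here w d = c N_K (g - 1), and the second claim for c N_K replaces it by a cycle z = v d. Then w -
   v (g - 1) is a cycle with the same H-norm as w. The other half exchanges N_H and g - 1. *)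
- have := ker_norm_submx_sub1 bM dL pP Kwd; rewrite -NdX => /(_ wd0)/submxP[c wd].
  have [_] := IHn j.+1 m _ lt_n (submxMl c (NK (C j.+1))).
  rewrite -[c *m _ *m _]mulmxA -wd -mulmxA diff_diff mulmx0.
  move=> /(_ erefl)[z zd0 wz]; have [v zv] := exact_lift zd0.
  exists (w - v *m Xg (C j)).
    by rewrite mulmxBl XdN wz zv subrr.
  by rewrite mulmxBl -mulmxA sub1_mul_norm mulmx0 subr0.
have := ker_sub1_submx_norm bM dL pP Kwd; rewrite -XdN => /(_ wd0)/submxP[c wd].
have [] := IHn j.+1 m _ lt_n (submxMl c (NK (C j.+1))).
rewrite -[c *m _ *m _]mulmxA -wd -mulmxA diff_diff mulmx0.
move=> /(_ erefl)[z zd0 wz] _; have [v zv] := exact_lift zd0.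
exists (w - v *m NH (C j)).
  by rewrite mulmxBl NdX wz zv subrr.
by rewrite mulmxBl -mulmxA norm_mul_sub1 mulmx0 subr0.
Qed.

(** This supplies [norm_lift]: [w *m d i] is a cycle of the form c N_K N_H, so c N_K may be replaced
    by a cycle, which is a boundary by exactness. *)
Lemma norm_boundary i m (w : 'M_(m, rdegree (C i))) :
    (w *m d i <= NK (C i.+1) *m NH (C i.+1))%MS ->
  exists v, w *m d i = v *m d i *m NH (C i.+1).
Proof.
case/submxP=> c wd; have [] := norm_cycles (submxMl c (NK (C i.+1))).
rewrite -[c *m _ *m _]mulmxA -wd -mulmxA diff_diff mulmx0.
move=> /(_ erefl)[z zd0 wz] _; have [v zv] := exact_lift zd0.
by exists v; rewrite -zv.
Qed.

Definition cycle_projection i (rho : 'M_(rdegree (C i))) : Prop :=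
  [/\ kG_hom rho, rho *m d i = 0 &
      forall m (z : 'M_(m, rdegree (C i))), z *m d i = 0 -> z *m rho = z].

(** Boolean, so that [xchoose] can select an inverse in every degree. *)
Definition regular_inverse i (r : 'M_(rdegree (C i.+1), rdegree (C i))) : bool :=
  kG_homb r && (d i *m r *m d i == d i).

Lemma cycle_projection0 : cycle_projection (0 : 'M_(rdegree (C 0%N))).
Proof.
split; [exact: kG_hom0 | by rewrite mul0mx | move=> m z /sub_kermxP zd0].
have [/andP[kd _] _] := exC.
by move: (submx_trans zd0 kd); rewrite submx0 => /eqP->; rewrite mul0mx.
Qed.

(** By exactness the cycles in degree i+1 are the vectors v d, and v d r d = v d. *)
Lemma cycle_projectionS i r :
  @regular_inverse i r -> cycle_projection (r *m d i).
Proof.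
case/andP=> /kG_homP hr /eqP drd; split; first exact: kG_homM (diff_hom C i).
  by rewrite -mulmxA diff_diff mulmx0.
by move=> m z /exact_lift[v ->]; rewrite mulmxA -(mulmxA v) -(mulmxA v) drd.
Qed.

Lemma ex_regular_inverse i : exists r, @regular_inverse i r.
Proof.
have step j : (exists rho, @cycle_projection j rho) -> exists r, @regular_inverse j r.
  move=> [rho [hrho rho_d rho_id]].
  have [L [P [dL pP [bM]]]] := decC j; have [L' [P' [dL' pP' [bN]]]] := decC j.+1.
  have [r hr drd] := diff_regular bM bN dL pP dL' pP' (diff_hom C j) hrho rho_d
    rho_id (@norm_boundary j).
  by exists r; rewrite /regular_inverse drd eqxx andbT; apply/kG_homP.
apply: (step); elim: i => [|i IHi]; first by exists 0; apply: cycle_projection0.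
by have [r /cycle_projectionS] := step i IHi; exists (r *m d i).
Qed.

Lemma rank2_contractible : contractible C.
Proof.
pose r i : 'M_(_, _) := xchoose (ex_regular_inverse i).
have rP i : regular_inverse (r i) := xchooseP (ex_regular_inverse i).
pose rho i : 'M_(rdegree (C i)) :=
  if i is j.+1 then r j *m d j else 0.
have rhoP i : cycle_projection (rho i).
  case: i => [|i] /=; [exact: cycle_projection0 | exact: cycle_projectionS].
(* The rows of d r - 1 are cycles, which 1 - [rho] kills. In the homotopy equation, s d = r d is the
   next [rho], and it cancels the one in d s = 1 - [rho]. *)
have d_s i : d i *m (r i *m (1%:M - rho i)) = 1%:M - rho i.
  have [_ _ rho_id] := rhoP i; have /andP[_ /eqP drd] := rP i.
  apply/eqP; rewrite -subr_eq0 mulmxA -[X in _ - X]mul1mx -mulmxBl.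
  by rewrite mulmxBr mulmx1 rho_id ?subrr // mulmxBl drd mul1mx subrr.
exists (fun i => r i *m (1%:M - rho i)); split=> [i | | i].
- have [hrho _ _] := rhoP i; have /andP[/kG_homP hr _] := rP i.
  by apply: kG_homM => //; apply: kG_homB => //; apply: kG_hom1.
- by rewrite d_s subr0.
have [_ rho_d _] := rhoP i.
by rewrite d_s -mulmxA mulmxBl mul1mx rho_d subr0 addrC subrK.
Qed.

End Complex.

End RankTwo.

(** * Terms of the complex and the splitting of E *)

Lemma in_Add_diag_plus_higman (k : fieldType) (gT : finGroupType)
    (G : {group gT}) (M : representation k G) :
  in_Add (@proj_or_onedim k gT G) M -> diag_plus_higman M.
Proof.
move=> [m [U [SU /diag_plus_higman_rsim]]]; apply.
elim/big_ind: _ => [|M1 M2|i _].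
- exact: rdegree0_diag_plus_higman.
- exact: diag_plus_higman_dadd.
case: (SU i) => [[_ /projective_higman] | deg1]; first exact: higman_diag_plus_higman.
apply: diagonal_diag_plus_higman => g _.
by case: (U i) deg1 => n rU /= n1; subst n; rewrite [rU g]mx11_scalar scalar_mx_is_diag.
Qed.

(** E has p + 1 > 1 subgroups of order p, and any two distinct ones span E as a direct product. *)
Lemma p2Elem_cycle_dprod (gT : finGroupType) (p : nat) (A E : {group gT}) :
  E \in 'E_p^2(A) ->
  exists (H K : {group gT}) (g : gT),
    [/\ H \x K = E, <[g]> = H, #|H| = p & #|K| = p].
Proof.
move=> Ep2; have p_pr := pnElem_prime Ep2.
have /card_gt1P[H [K [EpH EpK neqHK]]] : (1 < #|'E_p^1(E)|)%N.
  by rewrite (card_p1Elem_p2Elem Ep2) ltnS prime_gt0.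
have [oH oK] := (card_p1Elem EpH, card_p1Elem EpK).
have /cyclicP[g defH] : cyclic H by rewrite prime_cyclic ?oH.
by exists H, K, g; split=> //; apply/(p2Elem_dprodP Ep2 EpH EpK).
Qed.

Theorem theorem4p1 (k : fieldType) (p : nat) (gT : finGroupType)
    (G E : {group gT}) (l : nat) (C : cochain_complex k G) :
  p \in [pchar k] ->
  E \in 'E_p^2(G) ->
  bounded_by l C ->
  exact_complex C ->
  (forall i, (i <= l)%N -> in_Add (@proj_or_onedim k gT G) (C i)) ->
  contractible C.
Proof.
move=> pchark Ep2 bndC exC addC.
have [sEG abelE _] := pnElemP Ep2.
have [H [K [g [defE defH oH oK]]]] := p2Elem_cycle_dprod Ep2.
(* The complex is indexed by all natural numbers; above l its terms are zero modules. *)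
have decC i : diag_plus_higman (C i).
  have [/addC/in_Add_diag_plus_higman // | /bndC] := leqP i l.
  exact: rdegree0_diag_plus_higman.
exact: (rank2_contractible pchark sEG abelE defE defH oH oK bndC exC decC).
Qed.
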